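(* Let $p>1$ be fixed. Let $(a_n)_{n\ge 1}$ and $(b_n)_{n\ge 1}$ be sequences of positive real numbers with $a_1=b_1$, and let $A=(a_{n,k})_{n,k\ge 1}$ be the lower triangular matrix given by $a_{n,k}=b_k/a_n$ for $1\le k\le n$ and $a_{n,k}=0$ for $k>n$. Let $0<L<p$ and $\lambda_p=(1-L/p)^p$. Then $\|A\|_{p,p}\le p/(p-L)$ if for every integer $n\ge 1$ the following condition is satisfied: $$\left(\lambda_p^{1-1/p}\frac{a_{n+1}}{b_{n+1}}+1-\lambda_p^{1-1/p}\right)^{\frac1{p-1}}\left(\left(\lambda_p^{1-1/p}\frac{a_n}{b_n}+1-\lambda_p-\lambda_p^{1-1/p}\right)^{\frac1{p-1}}+\left(\frac{a_n}{b_{n+1}}\right)^{\frac p{p-1}}\right)\le\left(\frac{a_{n+1}}{b_{n+1}}\right)^{\frac p{p-1}}\left(\lambda_p^{1-1/p}\frac{a_n}{b_n}+1-\lambda_p-\lambda_p^{1-1/p}\right)^{\frac1{p-1}}.$$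
   Context: For $p\ge 1$, $l^p$ is the Banach space of complex sequences $\mathbf{x}=(x_n)_{n\ge1}$ with norm $\|\mathbf{x}\|_p=(\sum_{n=1}^\infty|x_n|^p)^{1/p}<\infty$. For a matrix $C=(c_{n,k})_{n,k\ge 1}$ acting on $l^p$ by $(C\mathbf{x})_n=\sum_{k=1}^\infty c_{n,k}x_k$, the operator norm is $\|C\|_{p,p}=\sup_{\|\mathbf{x}\|_p=1}\|C\mathbf{x}\|_p$. *)

(* Defs.v *)
From mathcomp Require Import all_boot all_order all_algebra.
From mathcomp Require Import all_classical all_reals all_analysis.
From mathcomp Require Import complex.

Set Implicit Arguments.
Unset Strict Implicit.
Unset Printing Implicit Defensive.

Import Order.TTheory GRing.Theory Num.Theory.
Import numFieldNormedType.Exports.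

Local Open Scope classical_set_scope.
Local Open Scope ring_scope.

(* Sequences and infinite matrices are indexed from 0: the terms [x n] and
   [C n k] are the usual $x_{n+1}$ and $c_{n+1,k+1}$. *)

(* The value is [+oo] exactly when x is not in l^p (for p > 0). *)
Definition lp_norm (R : realType) (p : R) (x : nat -> R[i]) : \bar R :=
  ((\sum_(0 <= n <oo) ((ComplexField.Normc.normc (x n)) `^ p)%:E)
     `^ p^-1)%E.

(* The ascription to [numClosedFieldType] gives R[i] the topology of its
   norm; the limit is a junk value when the series diverges. *)
Definition infmx_app (R : realType) (C : nat -> nat -> R[i])
    (x : nat -> R[i]) (n : nat) : R[i] :=
  lim (series ((fun k => C n k * x k) : nat -> (R[i] : numClosedFieldType))
         @ \oo).

Definition lp_opnorm (R : realType) (p : R) (C : nat -> nat -> R[i]) : \bar R :=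
  ereal_sup [set lp_norm p (infmx_app C x) | x in [set x | lp_norm p x = 1%E]].

Definition factorable_mx (R : realType) (a b : nat -> R) (n k : nat) : R[i] :=
  if (k <= n)%N then (b k / a n)%:C%C else 0.

(* Main.v *)
Require Import Defs.
From mathcomp Require Import all_boot all_order all_algebra.
From mathcomp Require Import all_classical all_reals all_analysis.
From mathcomp Require Import complex.
From mathcomp Require Import ring lra.

Set Implicit Arguments.
Unset Strict Implicit.
Unset Printing Implicit Defensive.

Import Order.TTheory GRing.Theory Num.Theory.
Import numFieldNormedType.Exports.

Local Open Scope classical_set_scope.
Local Open Scope ring_scope.

(** Write mu for lam `^ (1 - 1 / p), and for a complex sequence x put
    z n = |x n| and y n = (\sum_(k <= n) b k * z k) / a n, which dominates the
    modulus of the n-th coordinate of A x.  Since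
    (p / (p - L))^p = lam^-1, it suffices to prove, for all n,
    lam * \sum_(k <= n) (y k)^p <= \sum_(k <= n) (z k)^p.

    This follows by induction on n once the inequality is strengthened by an
    extra term c n * (y n)^p on its left side, where
    c n = mu * (a n / b n) + 1 - lam - mu.  The first entry gives equality
    because a 0 = b 0 and c 0 + lam = 1.  Passing from n to n + 1 amounts to
    (c (n+1) + lam) * (y (n+1))^p <= (z (n+1))^p + c n * (y n)^p,
    where a (n+1) * y (n+1) = b (n+1) * z (n+1) + a n * y n.  Hoelder's
    inequality for two terms, with the weight c n put on y n, gives the best
    constant in such an estimate, and the hypothesis of the theorem says
    precisely that this constant is good enough ([average_powR_step]).

    The weights c n have to be positive.  This is a consequence of the
    hypothesis: [ratio_gt1] shows inductively that a n / b n >= 1, and then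
    c n >= 1 - lam.  The induction is [averages_energy]; it is transferred to
    complex sequences and infinite sums by [normc_infmx_app_factorable] and
    [lp_opnorm_le]. *)

(** Hoelder's inequality for the vectors (u, v / c^(1/p)) and
    (x, c^(1/p) y): moving the weight from one factor to the other produces the
    power of c that appears in the constant. *)
Lemma weighted_hoelder2 (R : realType) (p c u v x y : R) :
  1 < p -> 0 < c -> 0 <= u -> 0 <= v -> 0 <= x -> 0 <= y ->
  (u * x + v * y) `^ p <=
    (u `^ (p / (p - 1)) + v `^ (p / (p - 1)) / c `^ (1 / (p - 1))) `^ (p - 1)
    * (x `^ p + c * y `^ p).
Proof.
move=> p1 c0 u0 v0 x0 y0.
have p0 : 0 < p by lra.
have pp0 : 0 < p - 1 by lra.
have cp0 : 0 < c `^ p^-1 by exact: powR_gt0.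
have -> : u * x + v * y = u * x + (v / c `^ p^-1) * (c `^ p^-1 * y).
  by congr (_ + _); rewrite mulrA divfK // gt_eqF.
have h := @hoelder2 R u (v / c `^ p^-1) x (c `^ p^-1 * y) (p / (p - 1)) p
  u0 (divr_ge0 v0 (ltW cp0)) x0 (mulr_ge0 (ltW cp0) y0) (divr_gt0 p0 pp0) p0.
have {}h := h ltac:(by field; rewrite ?gt_eqF).
apply: le_trans (ge0_ler_powR (ltW p0) _ _ h) _.
- by rewrite nnegrE addr_ge0 ?mulr_ge0 ?invr_ge0 ?powR_ge0.
- by rewrite nnegrE mulr_ge0 ?powR_ge0.
rewrite powRM ?powR_ge0 // -!powRrM mulVf ?gt_eqF //.
rewrite powRr1 ?addr_ge0 ?powR_ge0 //.
rewrite (powRM p (ltW cp0) y0) -powRrM mulVf ?gt_eqF // powRr1 ?(ltW c0) //.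
have -> : (p / (p - 1))^-1 * p = p - 1 by field; rewrite ?gt_eqF.
rewrite powRM ?invr_ge0 ?(ltW cp0) // -powRN -powRrM.
rewrite (_ : - p^-1 * (p / (p - 1)) = - (1 / (p - 1))) ?powRN //.
by field; rewrite ?gt_eqF.
Qed.

(** With q = p / (p - 1), weighted Hoelder bounds (a1 y1)^p by
    (b^q + a0^q / c^(1/(p-1)))^(p-1) times the right side.  The last hypothesis,
    multiplied by b^q / c^(1/(p-1)) and raised to the power p - 1, says that d
    times this constant is at most a1^p. *)
Lemma average_powR_step (R : realType) (p c d a0 a1 b x y0 y1 : R) :
  1 < p -> 0 < c -> 0 < d -> 0 < a0 -> 0 < a1 -> 0 < b ->
  0 <= x -> 0 <= y0 -> 0 <= y1 ->
  a1 * y1 = b * x + a0 * y0 ->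
  d `^ (1 / (p - 1)) * (c `^ (1 / (p - 1)) + (a0 / b) `^ (p / (p - 1)))
    <= (a1 / b) `^ (p / (p - 1)) * c `^ (1 / (p - 1)) ->
  d * y1 `^ p <= x `^ p + c * y0 `^ p.
Proof.
move=> p1 c0 d0 a00 a10 b0 x0 y00 y10 e h.
have pp0 : 0 < p - 1 by lra.
set s := 1 / (p - 1) in h; set q := p / (p - 1) in h.
have sp : s * (p - 1) = 1 by rewrite /s; field; rewrite gt_eqF.
have qp : q * (p - 1) = p by rewrite /q; field; rewrite gt_eqF.
have bq0 : 0 < b `^ q by exact: powR_gt0.
have cs0 : 0 < c `^ s by exact: powR_gt0.
set K := b `^ q + a0 `^ q / c `^ s.
have K0 : 0 < K by rewrite addr_gt0 ?divr_gt0 ?powR_gt0.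
have hK : d `^ s * K <= a1 `^ q.
  have bV z : 0 < z -> (z / b) `^ q = z `^ q / b `^ q.
    move=> /ltW z0; have b0' := ltW b0.
    by rewrite powRM ?invr_ge0 // -(powR_inv1 b0') powRAC powR_inv1 // ltW.
  rewrite !bV // in h.
  rewrite -(ler_pM2l (divr_gt0 cs0 bq0)).
  rewrite (_ : _ * (d `^ s * K)
             = d `^ s * (c `^ s + a0 `^ q / b `^ q)); last first.
    by rewrite /K; field; rewrite !gt_eqF.
  by rewrite (_ : _ * a1 `^ q = a1 `^ q / b `^ q * c `^ s) //; field; rewrite gt_eqF.
have hd : d * K `^ (p - 1) <= a1 `^ p.
  have := ge0_ler_powR (ltW pp0) _ _ hK.
  rewrite powRM ?powR_ge0 ?(ltW K0) // -!powRrM sp qp powRr1 ?(ltW d0) //; apply.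
    by rewrite nnegrE mulr_ge0 ?powR_ge0 ?ltW.
  by rewrite nnegrE powR_ge0.
have a1p : 0 < a1 `^ p by exact: powR_gt0.
rewrite -(ler_pM2l a1p) mulrCA -powRM ?(ltW a10) // e.
have E0 : 0 <= x `^ p + c * y0 `^ p by rewrite addr_ge0 ?mulr_ge0 ?powR_ge0 ?ltW.
apply: le_trans (ler_wpM2r E0 hd).
rewrite -mulrA ler_pM2l //.
by apply: weighted_hoelder2; rewrite // ltW.
Qed.

(** As t > 0, the hypothesis forces mu r + 1 - mu < r^p.  This fails for
    r <= 1: then r^p <= r, while mu r + 1 - mu lies between r and 1.  The proof
    compares the (p - 1)-th roots, the form in which the hypothesis comes. *)
Lemma ratio_gt1 (R : realType) (p mu r c t : R) :
  1 < p -> 0 < mu -> mu < 1 -> 0 < r -> 0 < c -> 0 < t ->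
  (mu * r + 1 - mu) `^ (1 / (p - 1)) * (c + t) <= r `^ (p / (p - 1)) * c ->
  1 < r.
Proof.
move=> p1 mu0 mu1 r0 c0 t0 h; rewrite ltNge; apply/negP => r1.
have pp0 : 0 < p - 1 by lra.
set d := mu * r + 1 - mu in h.
have d0 : 0 < d by rewrite /d; have := mulr_gt0 mu0 r0; lra.
have ds0 : 0 < d `^ (1 / (p - 1)) by exact: powR_gt0.
have rd : r <= d.
  rewrite /d -subr_ge0 (_ : _ - r = (1 - mu) * (1 - r)); last by ring.
  by rewrite mulr_ge0 ?subr_ge0 ?(ltW mu1).
suff : r `^ (p / (p - 1)) <= d `^ (1 / (p - 1)).
  move=> k; have := ler_wpM2r (ltW c0) k.
  have := mulr_gt0 ds0 t0; by move: h; rewrite mulrDr; lra.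
apply: (@le_trans _ _ (r `^ (1 / (p - 1)))).
  apply: ger_powR; first by rewrite r0 r1.
  by rewrite ler_pM2r ?invr_gt0 //; lra.
by apply: ge0_ler_powR; rewrite ?nnegrE ?divr_ge0 // ltW.
Qed.

(** The discrete Hardy-type inequality for nonnegative sequences.  The proof
    carries the additional term c n * (y n)^p, which each step converts into
    the next summand of the left side and the next additional term. *)
Lemma averages_energy (R : realType) (p lam mu : R) (a b : nat -> R) :
  1 < p -> 0 < lam -> lam < 1 -> 0 < mu -> mu < 1 ->
  (forall n, 0 < a n) -> (forall n, 0 < b n) -> a 0%N = b 0%N ->
  (forall n : nat,
    (mu * (a n.+1 / b n.+1) + 1 - mu) `^ (1 / (p - 1)) *
      ((mu * (a n / b n) + 1 - lam - mu) `^ (1 / (p - 1))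
       + (a n / b n.+1) `^ (p / (p - 1)))
    <= (a n.+1 / b n.+1) `^ (p / (p - 1)) *
       (mu * (a n / b n) + 1 - lam - mu) `^ (1 / (p - 1))) ->
  forall z : nat -> R, (forall n, 0 <= z n) -> forall n : nat,
  lam * \sum_(k < n) ((\sum_(j < k.+1) b j * z j) / a k) `^ p
    <= \sum_(k < n) z k `^ p.
Proof.
move=> p1 lam0 lam1 mu0 mu1 a0 b0 ab0 H z z0.
have r0 n : 0 < a n / b n by rewrite divr_gt0.
have r1 n : 1 <= a n / b n.
  elim: n => [|n ih]; first by rewrite ab0 divff // gt_eqF.
  apply: ltW; apply: (ratio_gt1 p1 mu0 mu1 (r0 _) _ _ (H n)).
    by apply: powR_gt0; have := ler_wpM2l (ltW mu0) ih; lra.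
  by rewrite powR_gt0 ?divr_gt0.
have c0 n : 0 < mu * (a n / b n) + 1 - lam - mu.
  by have := ler_wpM2l (ltW mu0) (r1 n); lra.
pose y n := (\sum_(j < n.+1) b j * z j) / a n.
have y0 n : 0 <= y n.
  rewrite divr_ge0 ?(ltW (a0 n)) ?sumr_ge0 // => i _.
  by rewrite mulr_ge0 ?(ltW (b0 _)).
(* The extra boundary term makes the inequality inductive; it is dropped at the
   end because its coefficient is positive. *)
have key n : lam * (\sum_(k < n.+1) y k `^ p)
    + (mu * (a n / b n) + 1 - lam - mu) * y n `^ p <= \sum_(k < n.+1) z k `^ p.
  elim: n => [|n ih].
    have -> : \sum_(k < 1) y k `^ p = z 0%N `^ p.
      rewrite big_ord1 /y big_ord1 /=; congr (_ `^ _).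
      by rewrite ab0; field; rewrite gt_eqF.
    have -> : y 0%N = z 0%N.
      by rewrite /y big_ord1 /= ab0; field; rewrite gt_eqF.
    rewrite big_ord1 ab0 divff ?gt_eqF //=.
    by rewrite -mulrDl (_ : lam + _ = 1) ?mul1r //=; ring.
  rewrite (big_ord_recr n.+1) [leRHS]big_ord_recr /=.
  have st : (mu * (a n.+1 / b n.+1) + 1 - mu) * y n.+1 `^ p <=
     z n.+1 `^ p + (mu * (a n / b n) + 1 - lam - mu) * y n `^ p.
    apply: (@average_powR_step R p _ _ (a n) (a n.+1) (b n.+1)) => //.
      by have := c0 n.+1; lra.
    rewrite /y [in LHS]big_ord_recr /=; field.
    by rewrite !gt_eqF.
  move: ih st.
  set S := \sum_(k < _) _; set T := \sum_(k < _) _.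
  set Y := y n.+1 `^ p; set Y' := y n `^ p.
  by nra.
case=> [|n]; first by rewrite !big_ord0 mulr0.
apply: le_trans (key n); rewrite lerDl mulr_ge0 ?powR_ge0 //.
exact: ltW.
Qed.

Lemma normc_sum (R : rcfType) n (f : nat -> R[i]) :
  ComplexField.Normc.normc (\sum_(k < n) f k) <=
  \sum_(k < n) ComplexField.Normc.normc (f k).
Proof.
elim: n => [|n ih]; first by rewrite !big_ord0 ComplexField.Normc.normc0.
by rewrite !big_ord_recr /=; apply: le_trans (le_normcD _ _) _; rewrite lerD2r.
Qed.

Lemma lim_series_finite (K : numClosedFieldType) (u : nat -> K) n :
  (forall k, (n <= k)%N -> u k = 0) -> lim (series u @ \oo) = \sum_(k < n) u k.
Proof.
move=> u0; apply: lim_near_cst; first exact: norm_hausdorff.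
near=> m; rewrite /series /=.
have nm : (n <= m)%N by near: m; exact: nbhs_infty_ge.
rewrite (big_cat_nat (n := n)) //= [X in _ + X]big1_seq ?addr0.
  by rewrite big_mkord.
by move=> k /=; rewrite mem_index_iota => /andP[/u0].
Unshelve. all: by end_near.
Qed.

Lemma infmx_app_factorable (R : realType) (a b : nat -> R) (x : nat -> R[i]) n :
  infmx_app (factorable_mx a b) x n = \sum_(k < n.+1) (b k / a n)%:C%C * x k.
Proof.
rewrite /infmx_app (@lim_series_finite _ _ n.+1).
  by apply: eq_bigr => k _; rewrite /factorable_mx -ltnS ltn_ord.
by move=> k nk; rewrite /factorable_mx leqNgt nk mul0r.
Qed.

Lemma normc_infmx_app_factorable (R : realType) (a b : nat -> R)
    (x : nat -> R[i]) n : (forall n, 0 < a n) -> (forall n, 0 < b n) ->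
  ComplexField.Normc.normc (infmx_app (factorable_mx a b) x n) <=
  (\sum_(k < n.+1) b k * ComplexField.Normc.normc (x k)) / a n.
Proof.
move=> a0 b0; rewrite infmx_app_factorable.
apply: le_trans (normc_sum _ (fun k => (b k / a n)%:C%C * x k)) _.
rewrite mulr_suml; apply: ler_sum => k _.
rewrite ComplexField.Normc.normcM /= expr0n /= addr0 sqrtr_sqr.
by rewrite ger0_norm ?divr_ge0 ?(ltW (a0 _)) ?(ltW (b0 _)) // mulrAC.
Qed.

(** Partial sums suffice: those of x are at most the full sum 1, and those of
    C x converge to the p-th power of its norm. *)
Lemma lp_opnorm_le (R : realType) (p lam : R) (C : nat -> nat -> R[i]) :
  0 < p -> 0 < lam ->
  (forall x n,
    lam * \sum_(k < n) ComplexField.Normc.normc (infmx_app C x k) `^ p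
      <= \sum_(k < n) ComplexField.Normc.normc (x k) `^ p) ->
  (lp_opnorm p C <= (lam^-1 `^ p^-1)%:E)%E.
Proof.
move=> p0 lam0 H; apply: ge_ereal_sup => _ [x /= x1 <-].
have norm_ge0 (u : nat -> R[i]) n : (0%N <= n)%N -> true ->
    (0 <= (ComplexField.Normc.normc (u n) `^ p)%:E)%E.
  by move=> _ _; rewrite lee_fin powR_ge0.
have S1 : (\sum_(0 <= n <oo) (ComplexField.Normc.normc (x n) `^ p)%:E = 1)%E.
  move/(congr1 (fun t => (t `^ p)%E)) : x1.
  rewrite /lp_norm -poweRrM mulVf ?gt_eqF // poweRe1 ?poweR1r //.
  by apply: nneseries_ge0 => n; exact: norm_ge0.
rewrite /lp_norm -poweR_EFin.
apply: gt0_ler_poweR; rewrite ?invr_ge0 ?(ltW p0) //.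
- by rewrite in_itv /= leey andbT; apply: nneseries_ge0 => n; exact: norm_ge0.
- by rewrite in_itv /= leey andbT lee_fin invr_ge0 ltW.
apply: lime_le; first by apply: is_cvg_nneseries => n; exact: norm_ge0.
near=> n; rewrite big_mkord sumEFin lee_fin -(ler_pM2l lam0) divff ?gt_eqF //.
apply: le_trans (H x n) _.
rewrite -lee_fin -S1 -sumEFin -(big_mkord xpredT
  (fun k => (ComplexField.Normc.normc (x k) `^ p)%:E)).
by apply: nneseries_lim_ge => k; exact: norm_ge0.
Unshelve. all: by end_near.
Qed.

Theorem theorem1p5 (R : realType) (p : R) (hp : 1 < p) (a b : nat -> R)
    (ha : forall n, 0 < a n) (hb : forall n, 0 < b n) (hab : a 0%N = b 0%N)
    (L : R) (hL0 : 0 < L) (hLp : L < p) :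
  let lam := (1 - L / p) `^ p in
  (forall n : nat,
    (lam `^ (1 - 1 / p) * (a n.+1 / b n.+1) + 1 - lam `^ (1 - 1 / p))
        `^ (1 / (p - 1)) *
      ((lam `^ (1 - 1 / p) * (a n / b n) + 1 - lam - lam `^ (1 - 1 / p))
          `^ (1 / (p - 1))
       + (a n / b n.+1) `^ (p / (p - 1)))
    <= (a n.+1 / b n.+1) `^ (p / (p - 1)) *
       (lam `^ (1 - 1 / p) * (a n / b n) + 1 - lam - lam `^ (1 - 1 / p))
          `^ (1 / (p - 1))) ->
  (lp_opnorm p (factorable_mx a b) <= (p / (p - L))%:E)%E.
Proof.
move=> lam H.
have p0 : 0 < p by lra.
have t0 : 0 < 1 - L / p by rewrite subr_gt0 ltr_pdivrMr // mul1r.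
have t1 : 1 - L / p < 1 by rewrite ltrBlDr ltrDl divr_gt0.
have powR_lt1 (u s : R) : 0 < u -> u < 1 -> 0 < s -> u `^ s < 1.
  move=> u0 u1 s0; rewrite -[ltRHS](congr1 (@^~ s) (@powR1 R)).
  by apply: gt0_ltr_powR; rewrite ?nnegrE ?ltW.
have lam0 : 0 < lam by exact: powR_gt0.
have lam1 : lam < 1 by exact: powR_lt1.
have mu1 : lam `^ (1 - 1 / p) < 1.
  by apply: powR_lt1 => //; rewrite subr_gt0 ltr_pdivrMr // mul1r.
have -> : p / (p - L) = lam^-1 `^ p^-1.
  rewrite -(powR_inv1 (ltW lam0)) powRAC /lam -[in _ `^ p^-1]powRrM divff ?gt_eqF //.
  rewrite (powRr1 (ltW t0)) (powR_inv1 (ltW t0)); field.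
  by rewrite !gt_eqF ?subr_gt0.
apply: lp_opnorm_le => // x n.
have nc0 (w : R[i]) : 0 <= ComplexField.Normc.normc w.
  by case: w => u v; exact: sqrtr_ge0.
apply: le_trans (averages_energy hp lam0 lam1 (powR_gt0 _ lam0) mu1 ha hb hab
  H (z := fun k => ComplexField.Normc.normc (x k)) _ n); last first.
  by move=> k; exact: nc0.
rewrite ler_pM2l //; apply: ler_sum => k _.
apply: ge0_ler_powR; rewrite ?nnegrE ?(ltW p0) //.
  rewrite divr_ge0 ?(ltW (ha _)) ?sumr_ge0 // => j _.
  by rewrite mulr_ge0 ?(ltW (hb _)).
exact: normc_infmx_app_factorable.
Qed.
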